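(* Let $A$ be a monoid, let $M$ be an $A$-set and let $cl$ be a closure operation of finite type on $SSet(M|A)$. Then the set $SSet^{cl}(M|A):=\{N\in SSet(M|A)\mid N=N^{cl}\}$, with the subspace topology of $SSet(M|A)$, is a spectral space. Moreover, $SSet^{cl}(M|A)$ is closed in $SSet(M|A)$ endowed with the patch topology.
   Context: A monoid means a commutative monoid, written multiplicatively, with identity $1$ and a base point $0$ satisfying $0\cdot a=0$ for all $a$. An $A$-set is a pointed set $(M,0_M)$ with an action $A\times M\to M$ satisfying $1\cdot x=x$, $0_A\cdot x=0_M$, $a\cdot 0_M=0_M$ and $(ab)\cdot x=a\cdot(b\cdot x)$. An $A$-subset of $M$ is a (pointed, i.e. containing $0_M$) subset $N\subseteq M$ with $ay\in N$ for all $a\in A$, $y\in N$; it is finitely generated if there is a finite subset $S\subseteq N$ such that every $x\in N$ is of the form $x=az$ with $a\in A$, $z\in S$. $SSet(M|A)$ is the set of all $A$-subsets of $M$, with the hull-kernel topology, i.e. the topology with open subbasis $\{N\in SSet(M|A)\mid F\nsubseteq N\}$, $F\subseteq M$ finite; this is a spectral space. A closure operation on $SSet(M|A)$ is a map $N\mapsto N^{cl}$ from $SSet(M|A)$ to itself such that $N\subseteq N^{cl}$; $N_1\subseteq N_2$ implies $N_1^{cl}\subseteq N_2^{cl}$; and $(N^{cl})^{cl}=N^{cl}$. It is of finite type if for every $N\in SSet(M|A)$, $N^{cl}=\bigcup\{L^{cl}\mid L\subseteq N,\ L\in SSet(M|A)\text{ finitely generated}\}$. A topological space is spectral if it is homeomorphic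 to the prime spectrum of a commutative ring with the Zariski topology. The patch topology on a spectral space $X$ has as an open subbasis the quasi-compact open sets of $X$ and their complements. *)

(* Defs.v *)
From HB Require Import structures.
From mathcomp Require Import all_boot all_algebra.
From mathcomp Require Import all_classical topology.

Set Implicit Arguments.
Unset Strict Implicit.
Unset Printing Implicit Defensive.

Import GRing.Theory.

Local Open Scope classical_set_scope.

(* Commutative monoids with an absorbing base point: the element written 0 on
   paper is [point]. The degenerate case 0 = 1 is allowed. *)
HB.mixin Record isMonoid0 A of Monoid A & Pointed A := {
  monoid0_mulC : forall a b : A, (a * b)%g = (b * a)%g;
  monoid0_mul0 : forall a : A, ((point : A) * a)%g = point
}.

#[short(type="monoid0Type")]
HB.structure Definition Monoid0 := {A of isMonoid0 A & Monoid A & Pointed A}.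

HB.mixin Record isASet (A : monoid0Type) M of Pointed M := {
  act : A -> M -> M;
  act_1 : forall x : M, act 1%g x = x;
  act_0l : forall x : M, act point x = point;
  act_0r : forall a : A, act a point = point;
  act_M : forall (a b : A) (x : M), act (a * b)%g x = act a (act b x)
}.

#[short(type="aSetType")]
HB.structure Definition ASet (A : monoid0Type) := {M of isASet A M & Pointed M}.

(* The type SSet(M|A). *)
Record SSet (A : monoid0Type) (M : aSetType A) := MkSSet {
  sset_carrier :> set M;
  sset_point : sset_carrier point;
  sset_act : forall (a : A) (y : M), sset_carrier y -> sset_carrier (act a y)
}.

Definition finitely_generated (A : monoid0Type) (M : aSetType A)
    (N : SSet M) : Prop :=
  exists S : set M, [/\ finite_set S, S `<=` N &
    forall x : M, sset_carrier N x -> exists (a : A) (z : M), S z /\ x = act a z].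

HB.instance Definition _ (A : monoid0Type) (M : aSetType A) :=
  gen_eqMixin (SSet M).
HB.instance Definition _ (A : monoid0Type) (M : aSetType A) :=
  gen_choiceMixin (SSet M).

(* The hull-kernel topology. *)
HB.instance Definition _ (A : monoid0Type) (M : aSetType A) :=
  @isSubBaseTopological.Build (SSet M) (set M) [set F | finite_set F]
    (fun F => [set N : SSet M | ~ (F `<=` N)]).

Definition closure_operation (A : monoid0Type) (M : aSetType A)
    (cl : SSet M -> SSet M) : Prop :=
  [/\ forall N : SSet M, N `<=` cl N,
      forall N1 N2 : SSet M, N1 `<=` N2 -> cl N1 `<=` cl N2 &
      forall N : SSet M, cl (cl N) = cl N].

Definition finite_type (A : monoid0Type) (M : aSetType A)
    (cl : SSet M -> SSet M) : Prop :=
  forall N : SSet M, sset_carrier (cl N) =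
    \bigcup_(L in [set L : SSet M | L `<=` N /\ finitely_generated L])
      sset_carrier (cl L).

Definition SSet_cl (A : monoid0Type) (M : aSetType A)
    (cl : SSet M -> SSet M) : set (SSet M) :=
  [set N | N = cl N].

(* The prime spectrum. The library's [prime_idealr] needs a nonzero ring; here
   the zero ring is allowed, so that the empty space is spectral. *)
Record Spec (R : comPzRingType) := MkSpec {
  prime_carrier :> set R;
  prime_0 : prime_carrier 0%R;
  prime_D : forall x y : R,
    prime_carrier x -> prime_carrier y -> prime_carrier (x + y)%R;
  prime_Ml : forall r x : R, prime_carrier x -> prime_carrier (r * x)%R;
  prime_proper : ~ prime_carrier 1%R;
  prime_prime : forall x y : R,
    prime_carrier (x * y)%R -> prime_carrier x \/ prime_carrier y
}.

HB.instance Definition _ (R : comPzRingType) := gen_eqMixin (Spec R).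
HB.instance Definition _ (R : comPzRingType) := gen_choiceMixin (Spec R).

Section Zariski.
Variable R : comPzRingType.

Definition zariski_closed (E : set R) : set (Spec R) := [set p | E `<=` p].

Definition zariski_open (U : set (Spec R)) : Prop :=
  exists E : set R, U = ~` zariski_closed E.

Lemma zariski_openT : zariski_open setT.
Proof.
exists setT; apply/esym/seteqP; split=> // p _ /(_ 1%R I).
exact: prime_proper.
Qed.

Lemma zariski_openI : setI_closed zariski_open.
Proof.
move=> _ _ [E ->] [F ->].
exists [set z | exists x y, [/\ E x, F y & z = (x * y)%R]].
apply/seteqP; split=> [p [nE nF] EFp | p nEF]; last first.
  split=> Xp; apply: nEF => _ [x [y [Ex Fy ->]]].
    by rewrite mulrC; apply/prime_Ml/Xp.
  exact/prime_Ml/Xp.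
apply: nE => x Ex; apply: contrapT => npx; apply: nF => y Fy.
by have [||//] := @prime_prime _ p x y; first by apply: EFp; exists x, y.
Qed.

Lemma zariski_open_bigU (I : Type) (f : I -> set (Spec R)) :
  (forall i, zariski_open (f i)) -> zariski_open (\bigcup_i f i).
Proof.
move=> /choice[E fE]; exists (\bigcup_i E i).
apply/seteqP; split=> [p [i _]|p nEp].
  by rewrite fE => nEp Ep; apply: nEp => x Ex; apply: Ep; exists i.
apply: contrapT => nfp; apply: nEp => x [i _ Ex]; apply: contrapT => npx.
by apply: nfp; exists i => //; rewrite fE => /(_ _ Ex).
Qed.

HB.instance Definition _ := isOpenTopological.Build (Spec R)
  zariski_openT zariski_openI zariski_open_bigU.

End Zariski.

Definition homeomorphic (X Y : topologicalType) : Prop :=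
  exists (f : X -> Y) (g : Y -> X),
    [/\ cancel f g, cancel g f, continuous f & continuous g].

Definition spectral (X : topologicalType) : Prop :=
  exists R : comPzRingType, homeomorphic X (Spec R).

(* A copy of X carrying the patch topology; [compact] does not include any
   separation axiom, so it means quasi-compact. *)
Definition patch_space (X : Type) : Type := X.

HB.instance Definition _ (X : topologicalType) :=
  Choice.copy (patch_space X) X.
HB.instance Definition _ (X : topologicalType) :=
  @isSubBaseTopological.Build (patch_space X) (set X)
    [set U | (open U /\ compact U) \/ (open (~` U) /\ compact (~` U))]
    (fun U => U).

(* Main.v *)
From HB Require Import structures.
Require Import Defs.
From mathcomp Require Import all_boot all_algebra.
From mathcomp Require Import finmap.
From mathcomp Require Import all_classical topology.
From mathcomp.multinomials Require Import monalg.

(** A closed A-subset N is determined by its coordinates, the truth values of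
    [m \in N] for m in M, and both halves of the theorem rest on one fact: an
    ultrafilter on closed A-subsets has a coordinatewise limit, and this limit
    is again a closed A-subset.  Indeed the limit is stable under the action
    because each condition involves one coordinate at a time, and it is
    closed because, for cl of finite type, [m \in cl N] depends on finitely
    many coordinates of N ([cl_finite_support]).  The same finiteness gives,
    around a non-closed N, a patch neighbourhood free of closed A-subsets: ask
    for the finitely many elements of N that force m into the closure, and
    forbid m.

    The definition of a spectral space asks for an actual ring.  Let X be a
    space whose points have coordinates in a set I, write V x for the set of
    coordinates that hold at x, and suppose that the sets where a coordinate
    fails form an open subbasis and that ultrafilters have coordinatewise
    limits.  The ring ([spring]) is the one of Hochster's theorem, in a form
    that reaches the final ring at once.  Take variables S_i, i in I, and the
    field K of rational functions in them.  For each W inside I, the degree in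
    the variables S_i with i in W, with the sign reversed, is a valuation of K
    trivial on the subfield K_W of rational functions in the other variables.
    An element of the ring is a function f on X that depends on finitely many
    coordinates, has f x in K_(V x), and is such that f x reduces to f y, for
    the valuation of V y, whenever y specializes x, that is, when V x is
    included in V y.

    Three facts make the points of X into all the prime ideals.
    - If b vanishes wherever a does, then a divides a power of b
      ([divides_power]): b^n / a, extended by 0, lies in the ring as soon as n
      exceeds the degrees of the denominators of the finitely many values
      of a.
    - Two elements a and b have the same common zeros as some a + n b
      ([common_zeros]), because each of the finitely many pairs of values
      excludes at most one integer n.
    - The function equal to 1/S_i where coordinate i fails and to 0 elsewhere
      lies in the ring ([separating_element]), so that points are separated.
    For a prime P, the first two facts show that the conditions a = 0 for a in
    P and b <> 0 for b outside P are compatible in finite number; a limit of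
    ultrafilter then gives a point where all of them hold
    ([prime_vanishing]).  Finally, f x <> 0 is an open condition
    ([nonzero_open]): it depends on finitely many coordinates and is inherited
    by generizations. *)

Set Implicit Arguments.
Unset Strict Implicit.
Unset Printing Implicit Defensive.

Import GRing.Theory Num.Theory.

Local Open Scope classical_set_scope.
Local Open Scope ring_scope.

(** * Polynomial rings in arbitrarily many variables *)

Definition mvpoly (I : choiceType) := {malg int[{cmonom I}]}.

Section MvPoly.
Variable I : choiceType.

HB.instance Definition _ := GRing.ComNzRing.on (mvpoly I).

(** The exponents of the variables in s, read as the digits of a number in
    base D: the substitution of [X ^ (D ^ r)] for the r-th variable. *)
Fixpoint digits_weight (D : nat) (s : seq I) (k : {cmonom I}) : nat :=
  if s is i :: s' then k i + D * digits_weight D s' k else 0.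

Lemma digits_weight1 D s : digits_weight D s mone = 0%N.
Proof. by elim: s => //= i s ->; rewrite cm1 muln0. Qed.

Lemma digits_weightM D s (k l : {cmonom I}) :
  digits_weight D s (mmul k l) = (digits_weight D s k + digits_weight D s l)%N.
Proof. by elim: s => //= i s ->; rewrite cmM mulnDr addnACA. Qed.

Lemma digits_weight_inj D s (k l : {cmonom I}) :
    (forall i, k i < D)%N -> (forall i, l i < D)%N ->
    digits_weight D s k = digits_weight D s l ->
  {in s, forall i, k i = l i}.
Proof.
move=> ltk ltl; elim: s => //= i s IH eqw.
have D_gt0 : (0 < D)%N by apply: leq_ltn_trans (ltk i).
have eqi : k i = l i.
  move/(congr1 (modn^~ D)): eqw.
  by rewrite ![(D * _)%N]mulnC ![(_ + _ * D)%N]addnC !modnMDl !modn_small.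
move=> j; rewrite inE => /predU1P[-> //|]; apply: IH.
by move/eqP: eqw; rewrite eqi eqn_add2l eqn_pmul2l // => /eqP.
Qed.

Lemma separating_weight (E : {fset {cmonom I}}) :
  exists D s, {in E &, injective (digits_weight D s)}.
Proof.
pose s := undup (flatten
    [seq enum_fset (finsupp (k : {cmonom I})) | k <- enum_fset E]).
pose D := (\max_(k <- enum_fset E) mdeg k).+1.
have ltD k i : k \in E -> (k i < D)%N.
  move=> kE; rewrite ltnS; apply: leq_trans (leq_bigmax_seq _ kE _) => //.
  rewrite mdegE; case: (mdomP k i) => // ki.
  by rewrite (big_fsetD1 i) //= leq_addr.
exists D, s => k l kE lE eqw.
have kl := digits_weight_inj (fun i => ltD k i kE) (fun i => ltD l i lE) eqw.
apply/eqP/cmP => i; have [/kl //|] := boolP (i \in s).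
rewrite mem_undup => nis.
have out m : m \in E -> m i = 0%N.
  move=> mE; apply/eqP; rewrite cmE_eq0; apply: contra nis => im.
  by apply/flattenP; exists (enum_fset (finsupp m)) => //; apply: map_f.
by rewrite !out.
Qed.

Section Specialize.
Variables (D : nat) (s : seq I).

Definition kronecker_monom (k : {cmonom I}) : {poly int} :=
  'X^(digits_weight D s k).

Fact kronecker_monom_morphism : mmorphism kronecker_monom.
Proof.
split=> [k l|]; rewrite /kronecker_monom ?digits_weight1 ?expr0 //.
by rewrite digits_weightM exprD.
Qed.
HB.instance Definition _ :=
  isMultiplicative.Build {cmonom I} {poly int} kronecker_monom
    kronecker_monom_morphism.

(** Kronecker substitution sends polynomials in any variables to polynomials
    in one; it preserves the coefficients of p as soon as the weight separates
    the monomials of p. *)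
Definition kronecker (p : mvpoly I) : {poly int} :=
  mmap polyC kronecker_monom p.

Lemma kroneckerM : {morph kronecker : p q / p * q}.
Proof. by move=> p q; rewrite /kronecker rmorphM. Qed.

Lemma kronecker_neq0 p :
  {in msupp p &, injective (digits_weight D s)} -> p != 0 -> kronecker p != 0.
Proof.
move=> injw; rewrite -msupp_eq0 => /fset0Pn[k kp].
apply/eqP => /(congr1 (fun u : {poly int} => u`_(digits_weight D s k))).
rewrite coef0 coef_sum (big_fsetD1 k) //= big_seq big1 ?addr0.
  by move=> /eqP; rewrite coefCM coefXn eqxx mulr1 mcoeff_eq0 kp.
move=> l; rewrite in_fsetD1 => /andP[lk lp]; rewrite coefCM coefXn.
case: eqP => [/(injw _ _ kp lp) kl|]; last by rewrite mulr0.
by rewrite kl eqxx in lk.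
Qed.

End Specialize.

(** Two nonzero polynomials stay nonzero under a common Kronecker
    substitution, and integer polynomials in one variable form a domain. *)
Lemma mvpoly_mulf_eq0 (p q : mvpoly I) : p * q = 0 -> (p == 0) || (q == 0).
Proof.
move=> pq0; apply: contraPT pq0; rewrite negb_or => /andP[p0 q0].
have [D [s injw]] := separating_weight (msupp p `|` msupp q)%fset.
move/(congr1 (kronecker D s)); rewrite kroneckerM.
have -> : kronecker D s 0 = 0 by rewrite /kronecker mmap0.
apply/eqP; rewrite mulf_neq0 // kronecker_neq0 // => k l kp lp; apply: injw;
  by rewrite in_fsetU ?kp ?lp ?orbT.
Qed.

Definition mvpoly_unit : pred (mvpoly I) := fun p => `[< exists q, q * p = 1 >].
Definition mvpoly_inv (p : mvpoly I) : mvpoly I :=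
  if pselect (exists q, q * p = 1) is left e then projT1 (cid e) else p.

Fact mvpoly_mulVr : {in mvpoly_unit, left_inverse 1 mvpoly_inv *%R}.
Proof.
move=> p; rewrite inE /mvpoly_inv => /asboolP pu.
case: pselect => [e|//]; first exact: projT2 (cid e).
by have /asboolP := pu.
Qed.
Fact mvpoly_unitP (p q : mvpoly I) : q * p = 1 -> mvpoly_unit p.
Proof. by move=> qp; apply/asboolP; exists q. Qed.
Fact mvpoly_inv_out : {in [predC mvpoly_unit], mvpoly_inv =1 id}.
Proof.
move=> p; rewrite inE /= => /asboolPn np.
by rewrite /mvpoly_inv; case: pselect.
Qed.

HB.instance Definition _ := GRing.ComNzRing_hasMulInverse.Build (mvpoly I)
  mvpoly_mulVr mvpoly_unitP mvpoly_inv_out.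
HB.instance Definition _ := GRing.ComUnitRing_isIntegral.Build (mvpoly I)
  mvpoly_mulf_eq0.

End MvPoly.

(** * The degree in a set of variables *)

Section Grading.
Variables (I : choiceType) (W : set I).

Definition wdeg (k : {cmonom I}) : nat :=
  (\sum_(i <- finsupp k | `[< W i >]) k i)%N.

Lemma wdegE (k : {cmonom I}) (d : {fset I}) : (finsupp k `<=` d)%fset ->
  wdeg k = (\sum_(i <- d | `[< W i >]) k i)%N.
Proof.
move=> le; rewrite /wdeg big_mkcond [RHS]big_mkcond (big_fset_incl _ le) //.
by move=> i _; rewrite -cmE_neq0 negbK => /eqP ->; rewrite if_same.
Qed.

Lemma wdeg1 : wdeg mone = 0%N.
Proof. by rewrite /wdeg mdom1 big_mkcond big_seq_fset0. Qed.

Lemma wdegM (k l : {cmonom I}) : wdeg (mmul k l) = (wdeg k + wdeg l)%N.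
Proof.
rewrite /wdeg mdomD -/(wdeg k) -/(wdeg l).
rewrite (wdegE (fsubsetUl _ (finsupp l))) (wdegE (fsubsetUr (finsupp k) _)).
by rewrite -big_split /=; apply: eq_bigr => i _; rewrite cmM.
Qed.

Lemma wdegU i : wdeg (ucm i) = `[< W i >].
Proof.
by rewrite /wdeg mdomU big_mkcond big_seq_fset1 cmUU; case: asboolP.
Qed.

Lemma wdeg_le k : (wdeg k <= mdeg k)%N.
Proof.
by rewrite /wdeg mdegE big_mkcond leq_sum // => i _; case: ifP.
Qed.

Definition graded_monom (k : {cmonom I}) : {poly mvpoly I} :=
  (<< k >> : mvpoly I)%:P * 'X^(wdeg k).

Lemma mvpolyXM (k l : {cmonom I}) :
  << mmul k l >> = << k >> * << l >> :> mvpoly I.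
Proof. by rewrite [RHS]fgmulUU mulr1. Qed.

Fact graded_monom_morphism : mmorphism graded_monom.
Proof.
split=> [k l|]; last by rewrite /graded_monom wdeg1 expr0 mulr1.
by rewrite /graded_monom wdegM exprD mvpolyXM polyCM mulrACA.
Qed.
HB.instance Definition _ :=
  isMultiplicative.Build {cmonom I} {poly mvpoly I} graded_monom
    graded_monom_morphism.

Definition graded_scalar (c : int) : {poly mvpoly I} := (c%:MP : mvpoly I)%:P.
HB.instance Definition _ := GRing.RMorphism.copy graded_scalar
  (polyC \o (malgC : int -> mvpoly I)).

(** Each variable of W is multiplied by the new variable X; the degree in X of
    the result is the total degree in the variables of W. *)
Definition graded : mvpoly I -> {poly mvpoly I} :=
  mmap graded_scalar graded_monom.
HB.instance Definition _ := GRing.RMorphism.copy graded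
  (mmap graded_scalar graded_monom).

Lemma horner1_monom (R : comNzRingType) (a b : R) n :
  (a%:P * (b%:P * 'X^n)).[1] = a * b.
Proof. by rewrite !hornerM !hornerC hornerXn expr1n mulr1. Qed.

Lemma size_monom_le (R : comNzRingType) (a b : R) (n : nat) :
  (size (a%:P * (b%:P * 'X^n))%R <= n.+1)%N.
Proof.
rewrite mulrA -polyCM mul_polyC -(size_polyXn R); exact: size_scale_leq.
Qed.

Lemma graded_horner1 p : (graded p).[1] = p.
Proof.
rewrite [RHS]monalgE /graded mmapE horner_sum; apply: eq_bigr => k _.
rewrite /graded_monom /graded_scalar horner1_monom.
by rewrite [LHS]fgmulUU mul1m mulr1.
Qed.

Lemma graded_var i :
  graded << ucm i >> = (<< ucm i >> : mvpoly I)%:P * 'X^(`[< W i >]).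
Proof.
have s1 : graded_scalar 1 = 1 by exact: rmorph1.
have -> : graded << ucm i >> = graded_scalar 1 * graded_monom (ucm i).
  exact: mmapU.
rewrite s1 -wdegU; exact: mul1r.
Qed.

End Grading.

(** The total degree bounds the degree in any set of variables.  This
    uniformity in W is what makes a single exponent work in
    [divides_power]. *)
Lemma size_graded_bound (I : choiceType) (p : mvpoly I) :
  exists n, forall W, (size (graded W p) <= n)%N.
Proof.
exists (\max_(k <- msupp p) (mdeg k).+1) => W; rewrite /graded mmapE.
apply: (leq_trans (size_sum _ _ _)); apply/bigmax_leqP_seq => k kp _.
apply: leq_trans (leq_bigmax_seq _ kp _) => //.
apply: leq_trans (size_monom_le _ _ _) _; rewrite ltnS; exact: wdeg_le.
Qed.

Lemma mvpoly_char0 (I : choiceType) (n : nat) :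
  n%:R = 0 :> mvpoly I -> n = 0%N.
Proof.
move=> n0; have : (n%:R : mvpoly I)@_mone = 0 by rewrite n0 mcoeff0.
rewrite -[n%:R]mpolyC_nat mcoeffC eqxx => /eqP.
by rewrite mulr1n pnatr_eq0 => /eqP.
Qed.

Lemma mvpolyX_neq0 (I : choiceType) (k : {cmonom I}) : << k >> != 0 :> mvpoly I.
Proof.
by apply/eqP => /(congr1 (mcoeff k)); rewrite mcoeffUU mcoeff0.
Qed.

(** All that the construction below uses of the polynomial ring. *)
Lemma graded_domain (I : choiceType) :
  exists (R : idomainType) (S : I -> R)
      (gr : set I -> {rmorphism R -> {poly R}}),
    [/\ forall W p, (gr W p).[1] = p,
        forall W i, gr W (S i) = (S i)%:P * 'X^(`[< W i >]),
        forall i, S i != 0,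
        forall p, exists n, forall W, (size (gr W p) <= n)%N &
        forall n : nat, n%:R = 0 :> R -> n = 0%N].
Proof.
exists (mvpoly I), (fun i => << ucm i >>), (fun W => @graded I W); split.
- exact: graded_horner1.
- exact: graded_var.
- by move=> i; apply: mvpolyX_neq0.
- exact: size_graded_bound.
- exact: mvpoly_char0.
Qed.

(** * The degree valuation on a field of fractions *)

Section PolySizes.
Variable R : idomainType.
Implicit Types P Q : {poly R}.

Lemma leq_size_mul P Q P' Q' :
    (size P <= size Q)%N -> (size P' <= size Q')%N ->
  (size (P * P')%R <= size (Q * Q')%R)%N.
Proof.
have [->|P0] := eqVneq P 0; first by rewrite mul0r size_poly0.
have [->|P'0] := eqVneq P' 0; first by rewrite mulr0 size_poly0.
move=> PQ PQ'; have Q0 : Q != 0.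
  by rewrite -size_poly_gt0 (leq_trans _ PQ) ?size_poly_gt0.
have Q'0 : Q' != 0.
  by rewrite -size_poly_gt0 (leq_trans _ PQ') ?size_poly_gt0.
by rewrite !size_mul // -!subn1 leq_sub2r // leq_add.
Qed.

Lemma ltn_size_mul P Q P' Q' : Q' != 0 ->
    (size P < size Q)%N -> (size P' <= size Q')%N ->
  (size (P * P')%R < size (Q * Q')%R)%N.
Proof.
move=> Q'0 PQ PQ'.
have Q0 : Q != 0 by rewrite -size_poly_gt0 (leq_ltn_trans _ PQ).
have [->|P0] := eqVneq P 0.
  by rewrite mul0r size_poly0 size_poly_gt0 mulf_neq0.
have [->|P'0] := eqVneq P' 0.
  by rewrite mulr0 size_poly0 size_poly_gt0 mulf_neq0.
move: PQ PQ' (P0); rewrite !size_mul // -size_poly_gt0.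
by case: (size P) (size Q) => [|m] [|n] //= mn le _; rewrite -addSn leq_add.
Qed.

End PolySizes.

Section Valuation.
Variables (R : idomainType) (g : {rmorphism R -> {poly R}}).
Hypothesis g1 : forall p, (g p).[1] = p.

Local Notation "p %:F" := (@FracField.tofrac R p) (format "p %:F").
Local Notation K := {fraction R}.
Implicit Types (a b c : K) (p q : R).

Lemma fractionP a : exists p q, q != 0 /\ a = p%:F / q%:F.
Proof.
elim/quotW: a => x; exists (frac x).1, (frac x).2.
split; first exact: denom_ratioP.
apply: (canRL (mulfK _)); first by rewrite tofrac_eq0 denom_ratioP.
unlock FracField.tofrac.
rewrite -[LHS]FracField.pi_mul; apply/eqmodP.
rewrite /= FracField.equivfE /FracField.mulf.
rewrite !numden_Ratio ?mulf_neq0 ?oner_eq0 ?denom_ratioP //.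
by rewrite !mulr1 mulrC.
Qed.

Lemma tofrac_neq0 p : p != 0 -> p%:F != 0.
Proof. by rewrite tofrac_eq0. Qed.

Lemma frac_eq p q p' q' : q != 0 -> q' != 0 ->
  p%:F / q%:F = p'%:F / q'%:F -> p * q' = p' * q.
Proof.
move=> q0 q'0 /eqP; rewrite eqr_div ?tofrac_neq0 // -!tofracM tofrac_eq.
by move/eqP.
Qed.

Lemma fracD p q p' q' : q != 0 -> q' != 0 ->
  p%:F / q%:F + p'%:F / q'%:F = (p * q' + p' * q)%:F / (q * q')%:F.
Proof.
by move=> q0 q'0; rewrite addf_div ?tofrac_neq0 // -!tofracM -tofracD.
Qed.

Lemma fracM p q p' q' :
  (p%:F / q%:F) * (p'%:F / q'%:F) = (p * p')%:F / (q * q')%:F.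
Proof. by rewrite mulf_div -!tofracM. Qed.

Lemma graded_neq0 p : p != 0 -> g p != 0.
Proof. by apply: contraNneq => gp; rewrite -(g1 p) gp horner0. Qed.

(** The value of p / q is deg q - deg p, where deg is the degree in X of the
    image under g.  Stating the sign of the value through some representation
    of a as a fraction makes the closure properties immediate; independence
    of the fraction is needed once, in [ground_pos_eq0]. *)
Definition val_pos a :=
  exists p q, [/\ q != 0, a = p%:F / q%:F & (size (g p) < size (g q))%N].

Definition val_ge0 a :=
  exists p q, [/\ q != 0, a = p%:F / q%:F & (size (g p) <= size (g q))%N].

(** The field of fractions of the ring of constants of g, on which the
    valuation is trivial. *)
Definition ground a :=
  exists p q, [/\ q != 0, a = p%:F / q%:F, g p = p%:P & g q = q%:P].

Lemma val_pos_ge0 a : val_pos a -> val_ge0 a.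
Proof. by case=> p [q [q0 -> /ltnW le]]; exists p, q. Qed.

Lemma ground_ge0 a : ground a -> val_ge0 a.
Proof.
case=> p [q [q0 -> gp gq]]; exists p, q; split => //.
by rewrite gp gq !size_polyC q0 leq_b1.
Qed.

Lemma val_pos0 : val_pos 0.
Proof.
exists 0, 1; rewrite tofrac0 mul0r oner_eq0 rmorph0 rmorph1 size_poly0.
by rewrite size_poly1.
Qed.

Lemma val_posD a b : val_pos a -> val_pos b -> val_pos (a + b).
Proof.
case=> p [q [q0 -> lt]] [p' [q' [q'0 -> lt']]].
exists (p * q' + p' * q), (q * q'); split; rewrite ?mulf_neq0 ?fracD //.
rewrite rmorphD !rmorphM (leq_ltn_trans (size_polyD _ _)) // gtn_max.
rewrite ltn_size_mul ?graded_neq0 //= [g q * _]mulrC.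
by rewrite ltn_size_mul ?graded_neq0.
Qed.

Lemma val_posM a b : val_pos a -> val_ge0 b -> val_pos (a * b).
Proof.
case=> p [q [q0 -> lt]] [p' [q' [q'0 -> lt']]].
exists (p * p'), (q * q'); split; rewrite ?mulf_neq0 ?fracM //.
by rewrite !rmorphM ltn_size_mul ?graded_neq0.
Qed.

Lemma val_posN a : val_pos a -> val_pos (- a).
Proof.
case=> p [q [q0 -> lt]]; exists (- p), q.
by rewrite q0 tofracN mulNr (rmorphN g) size_polyN.
Qed.

Lemma val_posB a b : val_pos a -> val_pos b -> val_pos (a - b).
Proof. by move=> va /val_posN; apply: val_posD. Qed.

Lemma val_ge0D a b : val_ge0 a -> val_ge0 b -> val_ge0 (a + b).
Proof.
case=> p [q [q0 -> lt]] [p' [q' [q'0 -> lt']]].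
exists (p * q' + p' * q), (q * q'); split; rewrite ?mulf_neq0 ?fracD //.
rewrite rmorphD !rmorphM (leq_trans (size_polyD _ _)) // geq_max.
by rewrite leq_size_mul //= [g q * _]mulrC leq_size_mul.
Qed.

Lemma ground0 : ground 0.
Proof. by exists 0, 1; rewrite tofrac0 mul0r oner_eq0 rmorph0 rmorph1. Qed.

Lemma ground1 : ground 1.
Proof. by exists 1, 1; rewrite tofrac1 divr1 oner_eq0 rmorph1. Qed.

Lemma groundD a b : ground a -> ground b -> ground (a + b).
Proof.
case=> p [q [q0 -> gp gq]] [p' [q' [q'0 -> gp' gq']]].
exists (p * q' + p' * q), (q * q'); split; rewrite ?mulf_neq0 ?fracD //.
  by rewrite rmorphD !rmorphM gp gq gp' gq' -!polyCM -polyCD.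
by rewrite rmorphM gq gq' -polyCM.
Qed.

Lemma groundM a b : ground a -> ground b -> ground (a * b).
Proof.
case=> p [q [q0 -> gp gq]] [p' [q' [q'0 -> gp' gq']]].
exists (p * p'), (q * q').
by rewrite mulf_neq0 // fracM !(rmorphM g) gp gp' gq gq' !polyCM.
Qed.

Lemma groundN a : ground a -> ground (- a).
Proof.
case=> p [q [q0 -> gp gq]]; exists (- p), q.
by rewrite tofracN mulNr (rmorphN g) gp polyCN.
Qed.

Lemma groundV a : ground a -> ground a^-1.
Proof.
case=> p [q [q0 -> gp gq]]; have [->|p0] := eqVneq p 0.
  by rewrite tofrac0 mul0r invr0; apply: ground0.
by exists q, p; rewrite invf_div.
Qed.

(** The valuation is trivial on the ground field, so its residue map is
    injective there: a reduction, when it exists, is unique. *)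
Lemma ground_pos_eq0 a : ground a -> val_pos a -> a = 0.
Proof.
case=> p [q [q0 -> gp gq]] [p' [q' [q'0 /(frac_eq q0 q'0) e lt]]].
have [->|p0] := eqVneq p 0; first by rewrite tofrac0 mul0r.
have p'0 : p' != 0.
  by apply: contraNneq (mulf_neq0 p0 q'0) => p'0; rewrite e p'0 mul0r.
move/(congr1 (fun u => size (g u))): e; rewrite !rmorphM /= gp gq.
by rewrite !size_Cmul // mulrC size_Cmul // => e; rewrite e ltnn in lt.
Qed.

(** The residue class of a is that of the element c of the ground field. *)
Definition reduces a c := ground c /\ val_pos (a - c).

Lemma reduces0 a : val_pos a -> reduces a 0.
Proof. by move=> pa; split; [exact: ground0|rewrite subr0]. Qed.

Lemma reduces_ground c : ground c -> reduces c c.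
Proof. by move=> gc; split; rewrite ?subrr //; exact: val_pos0. Qed.

Lemma reduces_ge0 a c : reduces a c -> val_ge0 a.
Proof.
by case=> /ground_ge0 gc /val_pos_ge0 pa; rewrite -(subrK c a); apply: val_ge0D.
Qed.

Lemma reducesB a c b d : reduces a c -> reduces b d -> reduces (a - b) (c - d).
Proof.
move=> [gc pa] [gd pb]; split; first exact/groundD/groundN.
by rewrite opprD addrACA -opprD; exact: val_posB.
Qed.

Lemma reducesM a c b d : reduces a c -> reduces b d -> reduces (a * b) (c * d).
Proof.
move=> rac [gd pb]; have [gc pa] := rac; split; first exact: groundM.
have -> : a * b - c * d = (b - d) * a + (a - c) * d.
  by rewrite !mulrBl [b * a]mulrC [d * a]mulrC addrA subrK.
apply: val_posD; apply: val_posM => //; first exact: reduces_ge0 rac.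
exact: ground_ge0.
Qed.

Lemma reducesX a c n : reduces a c -> reduces (a ^+ n) (c ^+ n).
Proof.
move=> rac; elim: n => [|n IH]; first exact/reduces_ground/ground1.
by rewrite !exprS; apply: reducesM.
Qed.

Lemma reduces_neq0 a c : reduces a c -> c != 0 -> a != 0.
Proof.
case=> gc pa; apply: contraNneq => a0; apply/eqP/(ground_pos_eq0 gc).
by move: pa; rewrite a0 sub0r => /val_posN; rewrite opprK.
Qed.

Lemma reducesV_ge0 a c : reduces a c -> c != 0 -> val_ge0 a^-1.
Proof.
case=> [[p [q [q0 -> gp gq]]]] [p' [q' [q'0 e lt]]] c0.
have p0 : p != 0 by apply: contraNneq c0 => ->; rewrite tofrac0 mul0r.
have ae : a = (p * q' + p' * q)%:F / (q * q')%:F.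
  by rewrite -fracD // -e addrC subrK.
have sz : size (g (p * q' + p' * q)) = size (g (q * q')).
  by rewrite rmorphD !rmorphM /= gp gq [_ * q%:P]mulrC size_polyDl !size_Cmul.
exists (q * q'), (p * q' + p' * q); rewrite ae invf_div sz leqnn; split=> //.
apply/eqP => e0; have := graded_neq0 (mulf_neq0 q0 q'0).
by rewrite -size_poly_eq0 -sz e0 rmorph0 size_poly0.
Qed.

Lemma reducesV a c : reduces a c -> c != 0 -> reduces a^-1 c^-1.
Proof.
move=> rac c0; have [gc pa] := rac; have a0 := reduces_neq0 rac c0.
split; first exact: groundV.
have -> : a^-1 - c^-1 = - (a - c) * a^-1 * c^-1.
  by rewrite opprB mulrBl mulfV // mulrBl mul1r mulrAC mulfV // mul1r.
apply: val_posM; last exact/ground_ge0/groundV.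
by apply: val_posM; [exact: val_posN|exact: reducesV_ge0 rac c0].
Qed.

(** A positive value is at least 1, so n times it beats the value of a once n
    exceeds the degree of the denominator of a. *)
Lemma val_pos_expr_div a p q n b :
    a != 0 -> q != 0 -> a = p%:F / q%:F -> (size (g q) <= n)%N ->
  val_pos b -> val_pos (b ^+ n / a).
Proof.
move=> a0 q0 ae le [r [s [s0 -> lt]]].
have p0 : p != 0 by apply: contraNneq a0 => p0; rewrite ae p0 tofrac0 mul0r.
exists (r ^+ n * q), (s ^+ n * p); split.
- by rewrite mulf_neq0 // expf_neq0.
- by rewrite ae invf_div expr_div_n !tofracM !tofracXn mulf_div.
rewrite !rmorphM !rmorphXn /=.
have gs := graded_neq0 s0; have gp := graded_neq0 p0; have gq := graded_neq0 q0.
have [->|r0] := eqVneq r 0.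
  rewrite rmorph0 expr0n eqn0Ngt (leq_trans _ le) ?size_poly_gt0 //.
  by rewrite mul0r size_poly0 size_poly_gt0 mulf_neq0 ?expf_neq0.
have gr := graded_neq0 r0.
rewrite !size_mul ?expf_neq0 // -[size (g r ^+ n)]prednK; last first.
  by rewrite size_poly_gt0 expf_neq0.
rewrite -[size (g s ^+ n)]prednK ?size_poly_gt0 ?expf_neq0 //.
rewrite !size_exp !addSn /=.
move: gs gp gq gr lt le; rewrite -!size_poly_gt0.
case: (size (g s)) (size (g r)) => [|y] [|x] //= _ + _ _.
move: (size (g p)) (size (g q)) => u v u0; rewrite ltnS => xy vn.
apply: (@leq_ltn_trans (y * n)); last by rewrite -addn1 leq_add2l.
by apply: (leq_trans _ (leq_mul xy (leqnn n))); rewrite mulSn addnC leq_add2r.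
Qed.

End Valuation.

(** * Finitely many coordinates *)

Lemma filter_forall_in (T : Type) (I : eqType) (F : set_system T) (G : seq I)
    (P : I -> set T) : Filter F ->
  (forall i, i \in G -> F (P i)) -> F [set x | forall i, i \in G -> P i x].
Proof.
move=> FF; elim: G => [|i G IH] GP; first exact: filterS filterT.
have {}IH := IH (fun j jG => GP j (mem_behead (s := i :: G) jG)).
apply: filterS (filterI (GP i (mem_head _ _)) IH) => x [Pi PG] j.
by rewrite inE => /predU1P[->|/PG].
Qed.

Section Agreement.
Variables (T : Type) (I : eqType) (V : T -> set I).

Definition agree (E : seq I) (x y : T) :=
  forall i, i \in E -> (V x i <-> V y i).

Lemma agree_sub (E E' : seq I) x y :
  {subset E <= E'} -> agree E' x y -> agree E x y.
Proof. by move=> sub xy i /sub /xy. Qed.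

(** A function of finitely many coordinates takes finitely many values, so a
    bound that exists for each value can be chosen uniformly. *)
Lemma uniform_bound (E : seq I) (Q : T -> nat -> Prop) :
    (forall x m n, (m <= n)%N -> Q x m -> Q x n) ->
    (forall x y n, agree E x y -> Q x n -> Q y n) ->
    (forall x, exists n, Q x n) ->
  exists n, forall x, Q x n.
Proof.
move=> Qmono Qagree Qex.
suff [n Qn] : exists n, forall x, setT x -> Q x n by exists n => x; apply: Qn.
have : forall x y n, setT x -> setT y -> agree E x y -> Q x n -> Q y n.
  by move=> x y n _ _; apply: Qagree.
elim: E setT {Qagree} => [|i E IH] D Qagree.
  have [[x Dx]|noD] := pselect (exists x, D x); last first.
    by exists 0%N => x Dx; case: noD; exists x.
  by have [n Qn] := Qex x; exists n => y Dy; apply: Qagree Qn.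
have [x y n [Dx Vx] [Dy Vy] xy|n1 Qn1] := IH [set x | D x /\ V x i].
  by apply: Qagree => // j; rewrite inE => /predU1P[->|/xy].
have [x y n [Dx Vx] [Dy Vy] xy|n2 Qn2] := IH [set x | D x /\ ~ V x i].
  by apply: Qagree => // j; rewrite inE => /predU1P[->|/xy].
exists (maxn n1 n2) => x Dx; have [Vx|Vx] := pselect (V x i).
  by apply: Qmono (leq_maxl _ _) _; apply: Qn1.
by apply: Qmono (leq_maxr _ _) _; apply: Qn2.
Qed.

Hypothesis V_compact : forall F : set_system T, UltraFilter F ->
  exists z, forall i, V z i <-> F [set x | V x i].

(** Compactness of the patch topology: conditions on finitely many coordinates
    that hold along a proper filter hold together at some point. *)
Lemma cluster_agree (F : set_system T) : ProperFilter F ->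
  exists z, forall (E : seq I) (C : set T),
    (forall x y, agree E x y -> C x -> C y) -> F C -> C z.
Proof.
move=> FF; have [G [GU FG]] := ultraFilterLemma FF.
have [z zG] := V_compact GU; exists z => E C Cagree /FG GC.
suff Gz : G [set x | agree E x z].
  have [x [Cx xz]] := filter_ex (filterI GC Gz).
  exact: Cagree Cx.
apply: filter_forall_in => i _.
have [Vz|Vz] := pselect (V z i).
  by move/zG: (Vz); apply: filterS => x /=.
have [/zG //|] := in_ultra_setVsetC [set x | V x i] GU.
by apply: filterS => x /=; tauto.
Qed.

End Agreement.
Arguments agree {T I} V E x y.

(** * The ring of functions whose spectrum is the given space *)

Section Spring.
Variables (I : choiceType) (R : idomainType) (S : I -> R).
Variable gr : set I -> {rmorphism R -> {poly R}}.
Hypothesis gr1 : forall W p, (gr W p).[1] = p.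
Hypothesis grS : forall W i, gr W (S i) = (S i)%:P * 'X^(`[< W i >]).
Hypothesis S_neq0 : forall i, S i != 0.
Hypothesis size_gr : forall p, exists n, forall W, (size (gr W p) <= n)%N.
Hypothesis R_char0 : forall n : nat, n%:R = 0 :> R -> n = 0%N.

Variables (T : topologicalType) (V : T -> set I).
Local Notation "p %:F" := (@FracField.tofrac R p) (format "p %:F").
Local Notation K := {fraction R}.

(** The relation between f x and f y, for x = y, contains the condition that
    f x is in the ground field of V x. *)
Definition spring_cond (f : T -> K) : Prop :=
  (forall x y, V x `<=` V y -> reduces (gr (V y)) (f x) (f y)) /\
  (exists E, forall x y, agree V E x y -> f x = f y).

Definition spring_pred : pred (T -> K) := fun f => `[< spring_cond f >].

Fact spring_pred_subring : subring_closed spring_pred.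
Proof.
split=> [|f h /asboolP[fr [E fE]] /asboolP[hr [E' hE]]
         |f h /asboolP[fr [E fE]] /asboolP[hr [E' hE]]]; apply/asboolP; split.
- by move=> x y _; exact/reduces_ground/ground1.
- by exists [::].
- by move=> x y xy; apply: reducesB (fr _ _ xy) (hr _ _ xy).
- exists (E ++ E') => x y xy; congr (_ - _); [apply: fE|apply: hE];
    by apply: agree_sub xy => i; rewrite mem_cat => ->; rewrite ?orbT.
- by move=> x y xy; apply: reducesM (fr _ _ xy) (hr _ _ xy).
- exists (E ++ E') => x y xy; congr (_ * _); [apply: fE|apply: hE];
    by apply: agree_sub xy => i; rewrite mem_cat => ->; rewrite ?orbT.
Qed.

Record spring := Spring { spring_fun :> T -> K; _ : spring_pred spring_fun }.
HB.instance Definition _ := [isSub for spring_fun].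
HB.instance Definition _ := [Choice of spring by <:].
HB.instance Definition _ :=
  GRing.SubChoice_isSubComPzRing.Build (T -> K) spring_pred spring
    spring_pred_subring.

Implicit Types (a b f h : spring).

Lemma springP f : spring_cond f.
Proof. by apply/asboolP; case: f. Qed.

Lemma spring0E x : (0 : spring) x = 0. Proof. by []. Qed.
Lemma spring1E x : (1 : spring) x = 1. Proof. by []. Qed.
Lemma springDE f h x : (f + h) x = f x + h x. Proof. by []. Qed.
Lemma springME f h x : (f * h) x = f x * h x. Proof. by []. Qed.
Lemma springXE f n x : (f ^+ n) x = f x ^+ n.
Proof. by elim: n => // n IH; rewrite !exprS springME IH. Qed.
Lemma springMnE f n x : (f *+ n) x = f x *+ n.
Proof. by elim: n => // n IH; rewrite !mulrS springDE IH. Qed.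

Lemma spring_inj f h : f =1 h -> f = h.
Proof. by move=> fh; apply/val_inj/funext. Qed.

Lemma spring_specialize f x y : V x `<=` V y -> reduces (gr (V y)) (f x) (f y).
Proof. by have [fr _] := springP f; apply: fr. Qed.

Lemma spring_neq0 f x y : V x `<=` V y -> f y != 0 -> f x != 0.
Proof. by move=> /(spring_specialize f); apply: reduces_neq0. Qed.

(** The inverse of S_i is in the ground field as long as i is not in W, and
    has value 1 otherwise; hence it reduces to 0 at the points where
    coordinate i holds. *)
Lemma inverse_variable_cond i :
  spring_cond (fun x => if `[< V x i >] then 0 else (S i)%:F^-1).
Proof.
split=> [x y xy|]; last first.
  exists [:: i] => x y /(_ i (mem_head _ _)) e.
  by rewrite (asbool_equiv_eq e).
have gS W : ~ W i -> gr W (S i) = (S i)%:P.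
  by move=> nW; rewrite grS asboolF // expr0 mulr1.
case: asboolP => [/xy Vy|Vx].
  by rewrite asboolT //; exact/reduces_ground/ground0.
case: asboolP => Vy; last first.
  apply: reduces_ground; exists 1, (S i).
  by rewrite tofrac1 mul1r rmorph1 gS.
apply: reduces0 => //; exists 1, (S i); rewrite tofrac1 mul1r; split => //.
rewrite rmorph1 size_poly1 grS asboolT // size_Mmonic ?monicXn //=.
  by rewrite size_polyXn size_polyC S_neq0.
by rewrite polyC_eq0.
Qed.

Lemma separating_element i : exists f, forall x, f x = 0 <-> V x i.
Proof.
exists (Spring (asboolT (inverse_variable_cond i))) => x /=.
case: asboolP => // Vx; split=> // /eqP; rewrite invr_eq0 tofrac_eq0.
by rewrite (negPf (S_neq0 i)).
Qed.

(** Each value of the pair (a, b) other than (0, 0) makes a + n b vanish for at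
    most one n, K being of characteristic 0, so every large n will do. *)
Lemma common_zeros a b :
  exists n, forall x, (a + b *+ n) x = 0 <-> a x = 0 /\ b x = 0.
Proof.
have [_ [E aE]] := springP a; have [_ [E' bE]] := springP b.
have natK n : n%:R = 0 :> K -> n = 0%N.
  by rewrite -(rmorph_nat (@FracField.tofrac R)) => /eqP;
    rewrite tofrac_eq0 => /eqP/R_char0.
pose Q x m := forall n, (m <= n)%N -> a x + b x *+ n = 0 -> a x = 0 /\ b x = 0.
have [|||n Qn] := @uniform_bound _ _ V (E ++ E') Q.
- by move=> x m n mn Qm k nk; apply: Qm; apply: leq_trans nk.
- move=> x y n xy; rewrite /Q.
  rewrite (aE x y); last by apply: agree_sub xy => i; rewrite mem_cat => ->.
  by rewrite (bE x y) // => i iE'; apply: xy; rewrite mem_cat iE' orbT.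
- move=> x.
  have [[m m0]|nom] := pselect (exists m, a x + b x *+ m = 0); last first.
    by exists 0%N => n _ n0; case: nom; exists n.
  exists m.+1 => n mn n0.
  have bx : b x = 0.
    have : b x * (n - m)%:R = 0.
      rewrite mulr_natr mulrnBr 1?ltnW //.
      apply/eqP; rewrite subr_eq0; apply/eqP.
      by apply: (addrI (a x)); rewrite n0 m0.
    move/eqP; rewrite mulf_eq0 => /orP[/eqP //|/eqP/natK/eqP].
    by rewrite subn_eq0 leqNgt mn.
  by move: n0; rewrite bx mul0rn addr0.
exists n => x; rewrite springDE springMnE; split; first exact: Qn.
by move=> [-> ->]; rewrite mul0rn addr0.
Qed.

(** The quotient b^n / a, with 1 / 0 = 0, is the required factor.  Where a has
    a nonzero reduction, its inverse reduces to the inverse of this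
    reduction.  Where a reduces to 0, so does b, and a large power of b
    compensates for the denominator. *)
Lemma divides_power a b : (forall x, a x = 0 -> b x = 0) ->
  exists n h, b ^+ n = a * h.
Proof.
move=> ab; have [_ [E aE]] := springP a; have [_ [E' bE]] := springP b.
(* W stands for V y, where y is any specialization of x. *)
pose Q x m := a x != 0 ->
  forall n W c, (m <= n)%N -> val_pos (gr W) c -> val_pos (gr W) (c ^+ n / a x).
have [|||n Qn] := @uniform_bound _ _ V E Q.
- by move=> x m n mn Qm ax k W c nk; apply: Qm => //; apply: leq_trans nk.
- by move=> x y n xy; rewrite /Q (aE x y).
- move=> x; have [p [q [q0 axE]]] := fractionP (a x); have [n nq] := size_gr q.
  exists n => ax m W c nm; apply: (val_pos_expr_div (gr1 W) ax q0 axE).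
  exact: leq_trans (nq W) nm.
(* A positive exponent makes b ^+ n.+1 vanish where a does. *)
have hP : spring_cond (fun x => b x ^+ n.+1 / a x).
  split=> [x y xy|]; last first.
    exists (E ++ E') => x y xy; rewrite (aE x y) ?(bE x y) //;
    by apply: agree_sub xy => i; rewrite mem_cat => ->; rewrite ?orbT.
  have ra := spring_specialize a xy; have rb := spring_specialize b xy.
  have [ay|ay] := eqVneq (a y) 0; last first.
    exact: reducesM (reducesX _ _ rb) (reducesV _ ra ay).
  rewrite ay invr0 mulr0; apply: reduces0 => //.
  have [->|ax] := eqVneq (a x) 0; first by rewrite invr0 mulr0; exact: val_pos0.
  apply: Qn => //; move: rb; rewrite (ab y ay) => -[_]; by rewrite subr0.
exists n.+1, (Spring (asboolT hP)); apply: spring_inj => x.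
rewrite springXE springME /=; have [ax|ax] := eqVneq (a x) 0.
  by rewrite ax (ab x ax) expr0n mul0r.
by rewrite mulrC divfK.
Qed.

Hypothesis V_inj : injective V.
Hypothesis V_open : forall i, open [set x | ~ V x i].
Hypothesis V_nbhs : forall x U, open U -> U x -> exists G : seq I,
  (forall i, i \in G -> ~ V x i) /\
  (forall y, (forall i, i \in G -> ~ V y i) -> U y).
Hypothesis V_compact : forall F : set_system T, UltraFilter F ->
  exists z, forall i, V z i <-> F [set x | V x i].

Lemma avoid_open (G : seq I) : open [set x | forall i, i \in G -> ~ V x i].
Proof.
rewrite openE => x xG; apply: filter_forall_in => i /xG Vi.
exact: open_nbhs_nbhs (conj (V_open i) Vi).
Qed.

(** Otherwise there would be zeros of f arbitrarily close to x, hence by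
    compactness a zero z that avoids every coordinate failing at x.  Such a z
    specializes to x, and f would not vanish at z since it does not at x. *)
Lemma nonzero_open f : open [set x | f x != 0].
Proof.
rewrite openE => x /= fx.
pose D := [set G : seq I | forall i, i \in G -> ~ V x i].
pose C (G : seq I) := [set y | f y = 0 /\ forall i, i \in G -> ~ V y i].
have [[G [DG CG]]|noG] := pselect (exists G, D G /\ forall y, ~ C G y).
  apply: filterS (open_nbhs_nbhs (conj (avoid_open G) DG)) => y /= Gy.
  by apply/eqP => fy; apply: CG (conj fy Gy).
have FF : ProperFilter (filter_from D C).
  apply: filter_from_proper; last first.
    move=> G DG; apply: contrapT => CG; apply: noG; exists G; split => // y Cy.
    by apply: CG; exists y.
  apply: filter_from_filter; first by exists [::].
  move=> G G' DG DG'; exists (G ++ G').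
    by move=> i; rewrite mem_cat => /orP[/DG|/DG'].
  move=> y [fy Gy]; split; split=> // i iG; apply: Gy;
    by rewrite mem_cat iG ?orbT.
have [z zF] := cluster_agree V_compact FF.
have [_ [E fE]] := springP f.
have fz : f z = 0.
  apply: (zF E [set y | f y = 0]).
    by move=> y y' yy' /= <-; rewrite (fE y y').
  by exists [::] => // y [].
have zx : V z `<=` V x.
  move=> i Vzi; apply: contrapT => Vxi; suff : ~ V z i by [].
  apply: (zF [:: i] [set y | ~ V y i]).
    by move=> y y' /(_ i (mem_head _ _)) yy' /=; rewrite yy'.
  exists [:: i]; first by move=> j; rewrite inE => /eqP ->.
  by move=> y [_]; apply; exact: mem_head.
by have := spring_neq0 zx fx; rewrite fz eqxx.
Qed.

Lemma separating_elements (G : seq I) :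
  exists f, forall x, f x != 0 <-> forall i, i \in G -> ~ V x i.
Proof.
elim: G => [|i G [f fG]]; first by exists 1 => x; rewrite oner_neq0.
have [h hi] := separating_element i; exists (h * f) => x.
rewrite springME mulf_eq0 negb_or; split=> [/andP[hx /fG fx] j|Gx].
  by rewrite inE => /predU1P[->|/fx //]; move/hi/eqP; rewrite (negPf hx).
apply/andP; split; first by apply/eqP => /hi; apply: Gx (mem_head _ _).
by apply/fG => j jG; apply: Gx; rewrite inE jG orbT.
Qed.

Definition vanishing (x : T) : Spec spring.
Proof.
refine (@MkSpec spring [set f : spring | f x = 0] _ _ _ _ _); rewrite /mkset.
- exact: spring0E.
- by move=> f h; rewrite springDE => -> ->; rewrite addr0.
- by move=> f h; rewrite springME => ->; rewrite mulr0.
- by rewrite spring1E; apply/eqP; rewrite oner_eq0.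
- move=> f h; rewrite springME => /eqP.
  by rewrite mulf_eq0 => /orP[] /eqP; tauto.
Defined.

(** The sets where a = 0 and b <> 0, for a in P and b outside P, form a filter
    basis: intersections are controlled by [common_zeros] and by primality,
    and none is empty by [divides_power].  Any limit point of this filter has
    P as its ideal. *)
Lemma prime_vanishing (P : Spec spring) : exists x, P = vanishing x.
Proof.
pose D := [set ab : spring * spring |
  prime_carrier P ab.1 /\ ~ prime_carrier P ab.2].
pose C (ab : spring * spring) := [set x | ab.1 x = 0 /\ ab.2 x != 0].
have PX b n : prime_carrier P (b ^+ n) -> prime_carrier P b.
  by elim: n => [/prime_proper //|n IH]; rewrite exprS => /prime_prime[|/IH].
have FF : ProperFilter (filter_from D C).
  apply: filter_from_proper; last first.
    move=> [a b] [/= Pa Pb]; apply: contrapT => Cab.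
    have [|n [h e]] := @divides_power a b.
      by move=> x ax; apply/eqP/negP => /negP bx; apply: Cab; exists x.
    by apply: Pb; apply: (PX _ n); rewrite e mulrC; apply: prime_Ml.
  apply: filter_from_filter.
    by exists (0, 1); split; [exact: prime_0|exact: prime_proper].
  move=> [a b] [a' b'] [/= Pa Pb] [/= Pa' Pb'].
  have [n nE] := common_zeros a a'; exists (a + a' *+ n, b * b').
    split=> [|/prime_prime[] //] /=; apply: prime_D => //.
    by rewrite -mulr_natl; apply: prime_Ml.
  move=> x [/nE[ax a'x] bb'x]; have : (b * b') x != 0 := bb'x.
  by rewrite springME mulf_eq0 negb_or => /andP[bx b'x].
have [z zF] := cluster_agree V_compact FF; exists z.
have vE f : prime_carrier P f <-> f z = 0.
  have [_ [E fE]] := springP f; split=> [Pf|fz]; last first.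
    apply: contrapT => Pf; suff : f z != 0 by rewrite fz eqxx.
    apply: (zF E [set y | f y != 0]).
      by move=> y y' yy' /=; rewrite (fE y y').
    by exists (0, f) => [|x []] //; split => //; exact: prime_0.
  apply: (zF E [set y | f y = 0]).
    by move=> y y' yy' /=; rewrite (fE y y').
  by exists (f, 1) => [|x []] //; split => //; exact: prime_proper.
case: P {D C PX FF zF} vE => P P0 PD PM P1 PP /= vE.
have {}vE : P = [set f | f z = 0] by apply/seteqP; split=> f /vE.
rewrite /vanishing; move: P0 PD PM P1 PP; rewrite vE => *.
by congr MkSpec; exact: Prop_irrelevance.
Qed.

Lemma vanishing_inj : injective vanishing.
Proof.
move=> x y xy; have e f : f x = 0 <-> f y = 0.
  by rewrite -[f x = 0]/(prime_carrier (vanishing x) f) xy.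
apply: V_inj; apply/seteqP; split=> i Vi;
  by have [f fi] := separating_element i; apply/fi/e/fi.
Qed.

Lemma spectral_spring : spectral T.
Proof.
have [point pointK] := choice prime_vanishing.
have vK : cancel vanishing point by move=> x; apply: vanishing_inj.
exists spring, vanishing, point; split=> //.
- apply/continuousP => _ [E ->].
  rewrite (_ : _ @^-1` _ = \bigcup_(f in E) [set x | f x != 0]).
    by apply: bigcup_open => f _; exact: nonzero_open.
  apply/seteqP; split=> [x /= nE|x [f Ef /= fx] /(_ f Ef)]; last exact/eqP.
  apply: contrapT => noE; apply: nE => f Ef /=; apply: contrapT => /eqP fx.
  by apply: noE; exists f.
apply/continuousP => U Uop.
exists [set f : spring | forall x, f x != 0 -> U x]; apply/seteqP; split=> P /=.
  rewrite [in X in ~ X](pointK P) => Ux EP; have [G [Gx GU]] := V_nbhs Uop Ux.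
  have [f fG] := separating_elements G.
  have /eqP : f (point P) = 0 by apply: (EP f) => x /fG /GU.
  by apply/negP/fG.
move=> EP; apply: contrapT => UP; apply: EP => f fU; rewrite (pointK P) /=.
by apply/eqP/negP => /negP /fU.
Qed.

End Spring.

(** A form of Hochster's theorem: any spectral space satisfies the hypotheses,
    taking for coordinates the complements of its quasi-compact open sets. *)
Lemma spectral_of_coordinates (T : topologicalType) (I : choiceType)
    (V : T -> set I) :
    injective V -> (forall i, open [set x | ~ V x i]) ->
    (forall x U, open U -> U x -> exists G : seq I,
      (forall i, i \in G -> ~ V x i) /\
      (forall y, (forall i, i \in G -> ~ V y i) -> U y)) ->
    (forall F : set_system T, UltraFilter F ->
      exists z, forall i, V z i <-> F [set x | V x i]) ->
  spectral T.
Proof.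
move=> V_inj V_open V_nbhs V_compact.
have [R [S [gr [gr1 grS S0 size_gr R0]]]] := graded_domain I.
exact: (spectral_spring gr1 grS S0 size_gr R0 V_inj V_open V_nbhs V_compact).
Qed.


(** * Spaces of subsets of a set with action *)

Section SSetSpace.
Variables (A : monoid0Type) (M : aSetType A).
Implicit Types (N : SSet M) (m : M) (G : seq M).

Lemma sset_carrier_inj : injective (@sset_carrier A M).
Proof.
move=> [N N0 Na] [N' N0' Na'] /= NN'; move: N0 Na N0' Na'; rewrite NN' => *.
by congr MkSSet; exact: Prop_irrelevance.
Qed.

Lemma sset_avoid_open m : open [set N | ~ sset_carrier N m].
Proof.
pose b (F : set M) := [set N : SSet M | ~ (F `<=` N)].
exists [set b [set m]].
  by move=> _ ->; apply: finI_from1; exact: finite_set1.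
rewrite bigcup_set1; apply/seteqP; split=> N; rewrite /b /= sub1set inE.
  by [].
by [].
Qed.

Lemma sset_open_avoid N (U : set (SSet M)) : open U -> U N ->
  exists G, (forall m, m \in G -> ~ sset_carrier N m) /\
    (forall N', (forall m, m \in G -> ~ sset_carrier N' m) -> U N').
Proof.
move=> [D Dfin <-] [B DB BN]; have [E _ EB] := Dfin _ DB.
have /choice[pick pickP] : forall F : set M, exists m,
    ~ (F `<=` N) -> F m /\ ~ sset_carrier N m.
  move=> F; have [FN|] := pselect (F `<=` N); first by exists point.
  by move=> /existsNP[m /not_implyP[Fm Nm]]; exists m.
have EN F : F \in E -> ~ (F `<=` N).
  have BN' : B N := BN.
  by move: BN'; rewrite -EB; apply.
exists (map pick (enum_fset E)).
split=> [_ /mapP[F /EN/pickP[_ NF] ->] //|N' GN'].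
exists B => //; suff : B N' by [].
rewrite -EB => F FE /(_ (pick F)) FN'.
have [Fm _] := pickP _ (EN _ FE).
by apply: (GN' (pick F)); [apply: map_f|apply: FN'].
Qed.

(** Membership in the limit is decided by the ultrafilter, one element of M at
    a time, and so is each instance of the axioms of A-subsets. *)
Lemma sset_ultra_limit (T : Type) (V : T -> SSet M) (F : set_system T) :
    UltraFilter F ->
  exists N, forall m, sset_carrier N m <-> F [set x | sset_carrier (V x) m].
Proof.
move=> FU.
have N0 : [set m | F [set x | sset_carrier (V x) m]] point.
  by apply: filterS filterT => x _; exact: sset_point.
have Na (a : A) (y : M) : [set m | F [set x | sset_carrier (V x) m]] y ->
    [set m | F [set x | sset_carrier (V x) m]] (act a y).
  by apply: filterS => x; exact: sset_act.
by exists (MkSSet N0 Na).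
Qed.

Lemma sset_avoid_compact m : compact [set N | ~ sset_carrier N m].
Proof.
rewrite compact_ultra => F FU Fm; have [N NF] := sset_ultra_limit id FU.
have out m' : ~ sset_carrier N m' -> F [set N' | ~ sset_carrier N' m'].
  by have [/NF|] := in_ultra_setVsetC [set N' | sset_carrier N' m'] FU.
exists N; split=> [/NF Nm|U].
  by have [N' [/= /[swap]]] := filter_ex (filterI Fm Nm).
rewrite nbhsE => -[B [Bop BN] BU]; apply: filterS BU _.
have [G [GN GB]] := sset_open_avoid Bop BN; apply: filterS GB _.
by apply: filter_forall_in => m' /GN /out.
Qed.

Variable cl : SSet M -> SSet M.
Hypothesis cl_closure : closure_operation cl.
Hypothesis cl_finite : finite_type cl.

Lemma finitely_generated_sub N (L : SSet M) (s : set M) : s `<=` N ->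
    (forall x, sset_carrier L x -> exists (a : A) z, s z /\ x = act a z) ->
  L `<=` N.
Proof. by move=> sN Ls x /Ls[a [z [sz ->]]]; apply/sset_act/sN. Qed.

(** Finite type, in terms of coordinates: m is in the closure of N because of
    finitely many elements of N. *)
Lemma cl_finite_support N m : sset_carrier (cl N) m ->
  exists G, (forall z, z \in G -> sset_carrier N z) /\
    (forall N', (forall z, z \in G -> sset_carrier N' z) ->
      sset_carrier (cl N') m).
Proof.
rewrite cl_finite => -[L [LN [s [sfin sL Ls]]] clLm].
have [G sG] := (finite_seqP s).1 sfin.
exists G; split=> [z zG|N' GN']; first by apply/LN/sL; rewrite sG.
have [_ cl_mono _] := cl_closure; apply: (cl_mono L) clLm.
by apply: finitely_generated_sub Ls => z; rewrite sG => /GN'.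
Qed.

Lemma SSet_clP N : SSet_cl cl N <-> cl N `<=` N.
Proof.
have [ext _ _] := cl_closure; split=> [<- //|clN].
by apply: sset_carrier_inj; apply/seteqP; split=> //; exact: ext.
Qed.

Lemma SSet_cl_spectral : spectral (set_type (SSet_cl cl)).
Proof.
apply: (@spectral_of_coordinates (set_type (SSet_cl cl)) M
  (fun x => sset_carrier (val x))).
- by move=> x y /sset_carrier_inj/val_inj.
- move=> m; exists [set N | ~ sset_carrier N m] => //.
  exact: sset_avoid_open.
- move=> x _ [U Uop <-] Ux; have [G [Gx GU]] := sset_open_avoid Uop Ux.
  by exists G; split => // y Gy; apply: GU.
move=> F FU.
have [N NF] := sset_ultra_limit (fun x : set_type (SSet_cl cl) => val x) FU.
suff Ncl : SSet_cl cl N by exists (exist _ N (mem_set Ncl)).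
apply/SSet_clP => m /cl_finite_support[G [GN Gm]]; apply/NF.
have FG : F [set x | forall z, z \in G -> sset_carrier (val x) z].
  by apply: filter_forall_in => z /GN /NF.
by apply: filterS FG => -[x xcl] /Gm; apply/(SSet_clP x).1; apply: set_mem xcl.
Qed.

(** If m is in cl N but not in N, the A-subsets that contain the finite support
    of m and avoid m form a patch neighbourhood of N without closed
    A-subsets. *)
Lemma SSet_cl_patch_closed : closed (SSet_cl cl : set (patch_space (SSet M))).
Proof.
have patch_open (B : set (SSet M)) :
    (open B /\ compact B) \/ (open (~` B) /\ compact (~` B)) ->
    open (B : set (patch_space (SSet M))).
  move=> BD; exists [set B]; last by rewrite bigcup_set1.
  by move=> _ ->; exact: (@finI_from1 _ _ _ id B BD).
have avoid_open m :
    open ([set N | ~ sset_carrier N m] : set (patch_space (SSet M))).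
  apply: patch_open; left.
  by split; [exact: sset_avoid_open|exact: sset_avoid_compact].
have contain_open m :
    open ([set N | sset_carrier N m] : set (patch_space (SSet M))).
  apply: patch_open; right.
  rewrite (_ : ~` _ = [set N | ~ sset_carrier N m]) //.
  by split; [exact: sset_avoid_open|exact: sset_avoid_compact].
rewrite -openC openE => N /= /SSet_clP /existsNP[m /not_implyP[clNm Nm]].
have [G [GN Gm]] := cl_finite_support clNm.
have NG : nbhs (N : patch_space (SSet M))
    [set N' | forall z, z \in G -> sset_carrier N' z].
  apply: filter_forall_in => z /GN Nz.
  exact: open_nbhs_nbhs (conj (contain_open z) Nz).
have Nm' := open_nbhs_nbhs (conj (avoid_open m) Nm).
apply: filterS (filterI NG Nm') => N' [/Gm clm nm].
by move/SSet_clP/(_ _ clm).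
Qed.

End SSetSpace.

Theorem proposition4p3 (A : monoid0Type) (M : aSetType A)
    (cl : SSet M -> SSet M)
    (cl_closure : closure_operation cl) (cl_finite : finite_type cl) :
  spectral (set_type (SSet_cl cl)) /\
  closed (SSet_cl cl : set (patch_space (SSet M))).
Proof.
split; first exact: SSet_cl_spectral.
exact: SSet_cl_patch_closed.
Qed.
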